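(* Let $k$ and $m$ be positive integers and let $t=\lceil\frac{m+1}{2}\rceil$. Let $G$ be a graph and $C\subseteq G$ a subgraph such that: (a) $\kappa(G)\geq k+1$; (b) $C$ is a complete graph of order $k$; (c) $G-V(C)$ is a bipartite graph and every vertex $u\in V(G)\setminus V(C)$ satisfies $d_G(u)\geq k+t$; (d) every pair of adjacent vertices in $V(G)\setminus V(C)$ have no common neighbor in $G$. Then for every vertex $v_0\in V(G)\setminus V(C)$ there exists a path $P$ of order $m$ in $G-V(C)$ starting from $v_0$ such that $\kappa(G-V(P))\geq k$.
   Context: All graphs are finite, simple and undirected. The connectivity $\kappa(G)$ of a graph $G$ is the minimum size of a vertex set $S$ such that $G-S$ is disconnected or has only one vertex. $d_G(u)$ denotes the degree of $u$ in $G$. The order of a path is its number of vertices. *)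

(* Defs.v *)
From mathcomp Require Import all_boot.

Set Implicit Arguments.
Unset Strict Implicit.
Unset Printing Implicit Defensive.

(* A graph carries its own vertex set inside an ambient finite type, so that
   its subgraphs and vertex-deleted subgraphs are graphs over the same type. *)
Record graph (T : finType) := Graph {
  verts : {set T};
  edge : rel T;
  edge_sym : symmetric edge;
  edge_irrefl : irreflexive edge;
  edge_verts : forall x y, edge x y -> x \in verts }.

Section Graphs.
Variable T : finType.
Implicit Types (G H : graph T) (S A B : {set T}).

Definition subgraph H G : Prop :=
  verts H \subset verts G /\ subrel (edge H) (edge G).

Definition del_edge G S : rel T :=
  [rel x y | [&& edge G x y, x \notin S & y \notin S]].

Lemma del_edge_sym G S : symmetric (del_edge G S).
Proof. by move=> x y; rewrite /del_edge /= (edge_sym G) (andbC (x \notin S)). Qed.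

Lemma del_edge_irrefl G S : irreflexive (del_edge G S).
Proof. by move=> x; rewrite /del_edge /= (edge_irrefl G). Qed.

Lemma del_edge_verts G S x y : del_edge G S x y -> x \in verts G :\: S.
Proof. by case/and3P=> /edge_verts xG xS _; rewrite inE xS. Qed.

(* G - S, for a set S of vertices *)
Definition del_verts G S : graph T :=
  Graph (@del_edge_sym G S) (@del_edge_irrefl G S) (@del_edge_verts G S).

Definition degree G (u : T) : nat := #|[set v | edge G u v]|.

Definition complete G : Prop :=
  {in verts G &, forall x y, x != y -> edge G x y}.

Definition bipartite G : Prop :=
  exists A B : {set T},
    [/\ A :|: B = verts G, [disjoint A & B],
        {in A &, forall x y, ~~ edge G x y}
      & {in B &, forall x y, ~~ edge G x y}].

Definition disconnected G : bool :=
  [exists x in verts G, exists y in verts G, ~~ connect (edge G) x y].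

Definition separating G S : bool :=
  [&& S \subset verts G
    & disconnected (del_verts G S) || (#|verts (del_verts G S)| == 1)].

(* The default value #|verts G| is only reached by the graph with no vertices,
   which gets connectivity 0: otherwise leaving a single vertex is allowed. *)
Definition connectivity G : nat :=
  \big[minn/#|verts G|]_(S : {set T} | separating G S) #|S|.

(* v :: p is the vertex sequence of a path of order m in G starting from v *)
Definition path_of_order G (m : nat) (v : T) (p : seq T) : bool :=
  [&& v \in verts G, path (edge G) v p, uniq (v :: p) & size (v :: p) == m].

End Graphs.

(* Main.v *)
Require Import Defs.
From mathcomp Require Import all_boot zify.

Set Implicit Arguments.
Unset Strict Implicit.
Unset Printing Implicit Defensive.

(* Induct on m, with the asymmetric degree bounds that survive the removal of
   v0: k + ceil(m/2) on the colour class of v0, k + floor(m/2) + 1 on the other.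
   If G - v0 is still (k+1)-connected, continue from any neighbour of v0 outside
   C.  Otherwise take a smallest F disjoint from C that is cut off in G - v0 by
   its k-element neighbourhood S.  Minimality of F makes the graph on F + S, with
   S turned into a clique, (k+1)-connected, and v0 has a neighbour in F; so this
   smaller graph, with S in the role of C, yields the rest of the path inside F.
   Absence of triangles makes small sets unable to be separated, which is what
   allows k-connectivity of the smaller graph to be transferred back. *)

Section Fragments.
Variable T : finType.
Implicit Types (e : rel T) (V C D F S Q X : {set T}).

(** * Neighbourhoods, cuts and connectivity of a relation on a vertex set *)

Definition nbhd e V D := [set y in V :\: D | [exists x in D, e x y]].

Definition cuts e V D : bool :=
  [&& D \subset V, D != set0 & ~~ (V \subset D :|: nbhd e V D)].

(** Separations are recorded by one side [D], whose neighbourhood is the separator. Keeping [e] and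
    [V] apart makes vertex deletion a change of [V] alone. *)
Definition kconn k e V : bool :=
  (k < #|V|) && [forall D : {set T}, cuts e V D ==> (k <= #|nbhd e V D|)].

Lemma nbhdP e V D y :
  reflect [/\ y \in V, y \notin D & exists2 x, x \in D & e x y]
          (y \in nbhd e V D).
Proof.
rewrite !inE; apply: (iffP idP).
  by case/andP=> /andP[-> ->] /exists_inP.
by case=> -> -> /exists_inP.
Qed.

Lemma nbhd_closed e V D x y :
  x \in D -> y \in V -> e x y -> y \in D :|: nbhd e V D.
Proof.
move=> xD yV exy; rewrite in_setU; case: (boolP (y \in D)) => //= yD.
by apply/nbhdP; split=> //; exists x.
Qed.

Lemma nbhd_sub e V D X :
  (forall x y, x \in D -> y \in V -> e x y -> y \in D :|: X) ->
  nbhd e V D \subset X.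
Proof.
move=> cl; apply/subsetP=> y /nbhdP[yV yD [x xD exy]].
by have := cl _ _ xD yV exy; rewrite inE (negPf yD).
Qed.

Lemma cutsP e V D :
  reflect [/\ D \subset V, exists x, x \in D
            & exists z, [/\ z \in V, z \notin D & z \notin nbhd e V D]]
          (cuts e V D).
Proof.
apply: (iffP and3P) => -[DV].
  move=> /set0Pn ex /subsetPn[z zV]; rewrite inE negb_or => /andP[zD zN].
  by split=> //; exists z.
move=> ex [z [zV zD zN]]; split=> //; first exact/set0Pn.
by apply/subsetPn; exists z; rewrite // inE negb_or zD.
Qed.

(** The form in which connectivity is exploited: [X] contains every exit from [D], hence its
    neighbourhood, and [z] certifies that something lies beyond. *)
Lemma kconn_cut k e V D X x z :
  kconn k e V -> D \subset V -> x \in D -> z \in V -> z \notin D :|: X ->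
  (forall a b, a \in D -> b \in V -> e a b -> b \in D :|: X) -> k <= #|X|.
Proof.
case/andP=> _ /forall_inP kV DV xD zV; rewrite inE negb_or => /andP[zD zX] cl.
have NX := nbhd_sub cl.
apply: leq_trans (subset_leq_card NX); apply: kV; apply/cutsP; split=> //.
  by exists x.
by exists z; split=> //; apply: contra zX; apply: (subsetP NX).
Qed.

Lemma nkconn k e V :
  k < #|V| -> ~~ kconn k e V -> exists2 D, cuts e V D & #|nbhd e V D| < k.
Proof.
rewrite /kconn => -> /=; rewrite negb_forall => /existsP[D].
by rewrite negb_imply -ltnNge => /andP[? ?]; exists D.
Qed.

(** Restoring [v] enlarges the neighbourhood of a set by at most [v] itself. *)
Lemma kconnD1 k e V v : kconn k.+1 e V -> kconn k e (V :\ v).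
Proof.
move=> kV; apply/andP; split.
  by case/andP: kV => kV _; have := cardsD1 v V; lia.
apply/forall_inP=> D /cutsP[DV [x xD] [z [/setD1P[zv zV] zD zN]]].
have: k < #|v |: nbhd e (V :\ v) D|.
  apply: (kconn_cut kV _ xD zV).
  - exact: subset_trans DV (subD1set _ _).
  - by rewrite !(in_setU, in_set1) !negb_or zv zD.
  move=> a b aD bV eab; rewrite setUCA; case: (eqVneq b v) => [->|bv].
    by rewrite setU11.
  by rewrite setU1r // (nbhd_closed aD) // !inE bv.
by rewrite cardsU1; lia.
Qed.

Lemma eq_kconn k e e' V : {in V &, e =2 e'} -> kconn k e V = kconn k e' V.
Proof.
move=> ee'; suff eN D : D \subset V -> nbhd e V D = nbhd e' V D.
  rewrite /kconn; congr andb; apply: eq_forallb => D; rewrite /cuts.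
  by case: (boolP (D \subset V)) => //= /eN->.
move=> /subsetP DV; apply/setP=> y; rewrite !in_set.
case: (boolP (y \in V)) => yV; last by rewrite andbF.
congr andb; apply: eq_existsb => x; case: (boolP (x \in D)) => //= /DV xV.
exact: ee'.
Qed.

Lemma card_lt_ex (A B : {set T}) :
  #|A| < #|B| -> exists2 x, x \in B & x \notin A.
Proof. by move=> lt; apply/subsetPn; apply: contraL lt => /subset_leq_card; lia. Qed.

(* A clique cannot meet both sides of a separation. *)
Lemma cuts_off_clique e V D C :
  symmetric e -> {in C &, forall x y, x != y -> e x y} -> cuts e V D ->
  exists F, [/\ cuts e V F, #|nbhd e V F| <= #|nbhd e V D|
              & [disjoint F & C]].
Proof.
move=> esym cliq cutD; have [DC|] := boolP [disjoint D & C].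
  by exists D.
case/pred0Pn=> c /andP[/= cD cC].
have [DV [x xD] [z [zV zD zN]]] := cutsP _ _ _ cutD.
(* When the clique meets [D], the far side [R] replaces [D]; by symmetry of [e] its neighbourhood
   lies inside that of [D]. *)
pose R := V :\: (D :|: nbhd e V D).
have NR : nbhd e V R \subset nbhd e V D.
  apply: nbhd_sub => a b; rewrite !in_setD in_setU negb_or.
  move=> /andP[/andP[aD aN] aV] bV eab.
  rewrite !(in_setU, in_setD) bV andbT negb_or.
  case: (boolP (b \in nbhd e V D)) => bN; first by rewrite orbT.
  rewrite andbT orbF; apply: contra aN => bD; rewrite esym in eab.
  by have := nbhd_closed bD aV eab; rewrite in_setU (negPf aD).
exists R; split; last 1 first.
- apply/pred0P=> y /=; apply/negP=> /andP[]; rewrite in_setD => /andP[yD yV] yC.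
  suff /(nbhd_closed cD yV) : e c y by apply/negP.
  apply: cliq => //; apply: contraNneq yD => <-; by rewrite inE cD.
- apply/cutsP; split; first exact: subsetDl.
    by exists z; rewrite !in_setD zV in_setU negb_or zD zN.
  exists c; split; first exact: (subsetP DV).
    by rewrite !in_setD in_setU cD.
  apply/negP=> /(subsetP NR) /nbhdP[_]; by rewrite cD.
exact: subset_leq_card.
Qed.

(** * Transferring connectivity from a completed fragment back to the whole graph *)

Definition add_clique e S : rel T :=
  [rel x y | e x y || (x \in S) && (y \in S)].

Definition deg e V u := #|[set y in V | e u y]|.

(** The neighbourhoods of [u] and [v] in [V] are disjoint and both lie in [D :|: X]. *)
Lemma triangle_free_card k e V X D u v :
  k <= deg e V u -> k <= deg e V v ->
  (forall w, w \in V -> ~~ (e u w && e v w)) ->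
  (forall w, w \in V -> e u w || e v w -> w \in D :|: X) ->
  k.*2 <= #|D| + #|X|.
Proof.
rewrite /deg => du dv tf cl.
have dis : [disjoint [set y in V | e u y] & [set y in V | e v y]].
  apply/pred0P=> w /=; rewrite !inE.
  by case: (boolP (w \in V)) => //= /tf/negPf.
(* Disjointness is the equality case of subadditivity of cardinals. *)
rewrite -(geq_leqif (leq_card_setU _ _)) in dis.
have : #|[set y in V | e u y] :|: [set y in V | e v y]| <= #|D :|: X|.
  apply/subset_leq_card/subsetP=> w; rewrite !in_set -andb_orr => /andP[wV ew].
  by have := cl w wV ew; rewrite in_setU.
have := (leq_card_setU D X).1; lia.
Qed.

(* Let D, disjoint from C, have a neighbourhood X with #|X| < k in V - Q.
   Separating F + D from C gives #|S & D| <= #|X - F - S|; then D & F, cut off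
   from S - D, is empty; separating F - Q - X from S & D gives
   #|S & D| <= #|X & F|; so D - S has fewer than k neighbours in V and is empty.
   Finally D, inside S, has fewer than k elements, too few for the disjoint
   neighbourhoods of two adjacent vertices. *)
Lemma kconn_glue k e V C S F Q u v :
  symmetric e -> kconn k e V ->
  F \subset V -> S \subset V -> [disjoint F & S] -> #|S| = k ->
  (forall x y, x \in F -> y \in V -> e x y -> y \in F :|: S) ->
  C \subset V -> #|C| = k -> [disjoint F & C] ->
  {in C &, forall x y, x != y -> e x y} ->
  Q \subset F -> kconn k (add_clique e S) ((F :|: S) :\: Q) ->
  (forall x, x \in V :\: C -> k <= deg e (V :\: Q) x) ->
  (forall x y, x \in V :\: C -> y \in V :\: C -> e x y ->
     forall w, w \in V -> ~~ (e x w && e y w)) ->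
  u \in F -> v \in F -> e u v -> kconn k e (V :\: Q).
Proof.
move=> esym kV FV SV FS cS clF CV cC FC cliq QF kFS degk tf uF vF euv.
have inV x : x \in F -> x \in V := subsetP FV x.
have FVC x : x \in F -> x \in V :\: C.
  by move=> xF; rewrite inE inV // (disjointFr FC).
have FSV : F :|: S \subset V by rewrite subUset FV.
have bigV : k < #|V :\: Q|.
  by case/andP: kFS => lt _; apply: leq_trans lt (subset_leq_card (setSD _ _)).
apply: contraT => /(nkconn bigV)[D0 cutD0 ltD0].
have [D [cutD leD DC]] := cuts_off_clique esym cliq cutD0.
have [DV [x xD] _] := cutsP _ _ _ cutD.
set X := nbhd e (V :\: Q) D in leD.
have ltX : #|X| < k by apply: leq_ltn_trans ltD0.
have clD : forall a b, a \in D -> b \in V :\: Q -> e a b -> b \in D :|: X.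
  by move=> a b aD bV; apply: nbhd_closed.
(* From here on [X] is just a set of fewer than [k] vertices that contains every exit from [D] in
   [V :\: Q]. *)
clearbody X.
have FSd y : y \in S -> y \in F = false by move=> yS; rewrite (disjointFl FS).
have DVC y : y \in D -> y \in V :\: C.
  by move=> yD; have := subsetP DV _ yD; rewrite !inE (disjointFr DC yD) => /andP[_ ->].
have QS y : y \in S -> y \notin Q.
  by move=> yS; apply/negP=> /(subsetP QF); rewrite FSd.
have [eXF eXS] := (cardsID F X, cardsID S (X :\: F)).
have eXFS : (X :\: F) :&: S = X :&: S.
  apply/setP=> y; rewrite !inE; case: (boolP (y \in S)); rewrite ?andbF ?andbT //.
  by move=> /FSd ->.
rewrite eXFS in eXS.
have eS := cardsID D S.
have h1 : #|S :&: D| <= #|X :\: F :\: S|.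
  suff : k <= #|(X :\: F :\: S) :|: (S :\: D)|.
    have := (leq_card_setU (X :\: F :\: S) (S :\: D)).1.
    by move: eS cS; clear; lia.
  (* A separator with fewer than [k] vertices misses some [c] in [C], and [c] lies beyond [F :|: D]
     because both sets avoid [C]. *)
  rewrite leqNgt; apply/negP=> lt; rewrite -cC in lt.
  have [c cCC cZ] := card_lt_ex lt.
  suff : k <= #|(X :\: F :\: S) :|: (S :\: D)| by rewrite -cC leqNgt lt.
  apply: (kconn_cut (D := F :|: D) (x := u) (z := c) kV).
  - by rewrite subUset FV (subset_trans DV (subsetDl _ _)).
  - by rewrite inE uF.
  - exact: (subsetP CV).
  - by rewrite inE (negPf cZ) orbF inE negb_or (disjointFl FC) // (disjointFl DC).
  move=> a b aFD bV eab.
  have [aF|aF] := boolP (a \in F).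
    have := clF _ _ aF bV eab; rewrite !inE.
    by case: (b \in F) => //=; case: (b \in D) => //= ->; rewrite orbT.
  have aD : a \in D by move: aFD; rewrite inE (negPf aF).
  case: (boolP (b \in Q)) => [/(subsetP QF) bF|bQ]; first by rewrite !inE bF.
  have bVQ : b \in V :\: Q by rewrite inE bQ.
  have := clD _ _ aD bVQ eab; rewrite in_setU !in_setU !in_setD.
  by case: (b \in F); case: (b \in D); case: (b \in S) => //= ->.
have h2 : [disjoint D & F].
  apply: contraT => /pred0Pn[a /andP[/= aD aF]].
  (* By [h1], replacing [X :\: F :\: S] by [S :&: D] does not raise the total above [#|X|], which is
     less than [k]. *)
  have lt : #|X :&: F :|: X :&: S :|: S :&: D| < #|S|.
    have := (leq_card_setU (X :&: F :|: X :&: S) (S :&: D)).1.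
    have := (leq_card_setU (X :&: F) (X :&: S)).1.
    by move: h1 eXF eXS ltX cS; clear; lia.
  have [s sS sX] := card_lt_ex lt.
  suff : k <= #|X :&: F :|: X :&: S :|: S :&: D| by rewrite -cS leqNgt lt.
  apply: (kconn_cut (D := D :&: F) (x := a) (z := s) kFS).
  - apply/subsetP=> y; rewrite !inE => /andP[yD ->].
    by have := subsetP DV _ yD; rewrite !inE => /andP[-> _].
  - by rewrite inE aD.
  - by rewrite !inE QS // sS orbT.
  - by rewrite in_setU (negPf sX) orbF inE FSd // andbF.
  move=> p q; rewrite in_setI => /andP[pD pF].
  rewrite in_setD in_setU => /andP[qQ qFS] /orP[epq|/andP[pS _]]; last first.
    by rewrite FSd in pF.
  have qV : q \in V :\: Q by rewrite inE qQ (subsetP FSV) // inE.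
  have := clD _ _ pD qV epq; rewrite !in_setU !in_setI.
  by case/orP: qFS => ->; case: (q \in D); rewrite /= ?andbT ?orbT //= => ->; rewrite ?orbT.
have DF y : y \in D -> y \in F = false by move=> yD; rewrite (disjointFr h2).
(* The disjoint neighbourhoods of [u] and [v] outside [Q] fit into [F :\: Q] and the [k] vertices of
   [S]. *)
have degF0 : k <= #|F :\: Q|.
  suff : k.*2 <= #|F :\: Q| + #|S| by move: cS; clear; lia.
  apply: (triangle_free_card (degk _ (FVC _ uF)) (degk _ (FVC _ vF))).
    by move=> w /setDP[wV _]; apply: tf => //; apply: FVC.
  move=> w /setDP[wV wQ] ew; have : w \in F :|: S.
    by case/orP: ew; apply: clF.
  by rewrite !inE wQ.
have h3 : #|S :&: D| <= #|X :&: F|.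
  have [->|/set0Pn[s /setIP[sS sD]]] := eqVneq (S :&: D) set0; first by rewrite cards0.
  have [f /setDP[fF fQ] fX] : exists2 f, f \in F :\: Q & f \notin X.
    by apply: card_lt_ex; apply: leq_trans degF0.
  suff : k <= #|X :&: F :|: S :\: D|.
    have := (leq_card_setU (X :&: F) (S :\: D)).1.
    by move: eS cS; clear; lia.
  apply: (kconn_cut (D := F :\: Q :\: X) (x := f) (z := s) kFS).
  - apply/subsetP=> y; rewrite !inE => /and3P[_ -> ->] //.
  - by rewrite !inE fX fQ.
  - by rewrite !inE QS // sS orbT.
  - by rewrite !inE sD FSd // !andbF.
  move=> p q; rewrite !in_setD => /and3P[pX pQ pF].
  rewrite in_setU => /andP[qQ qFS] /orP[epq|/andP[pS _]]; last first.
    by rewrite FSd in pF.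
  rewrite !in_setU in_setI !in_setD qQ.
  case/orP: qFS => [->|qS]; first by case: (q \in X).
  (* If [q] were in [D], its neighbour [p] would lie in [D :|: X]; but [p] is outside [X], and [D]
     misses [F]. *)
  rewrite qS !andbT; apply/orP; right; apply/orP; right; apply/negP=> qD.
  rewrite esym in epq; have pV : p \in V :\: Q by rewrite inE pQ inV.
  by have := clD _ _ qD pV epq; rewrite inE (negPf pX) orbF => /DF; rewrite pF.
have h4 : D \subset S.
  apply: contraT => /subsetPn[a aD aS].
  suff : k <= #|(X :\: F) :|: S :&: D|.
    have := (leq_card_setU (X :\: F) (S :&: D)).1.
    by move: h3 eXF ltX; clear; lia.
  apply: (kconn_cut (D := D :\: S) (x := a) (z := u) kV).
  - exact: subset_trans (subsetDl _ _) (subset_trans DV (subsetDl _ _)).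
  - by rewrite inE aS.
  - exact: inV.
  - by rewrite !inE uF (disjointFl h2 uF) !andbF.
  move=> p q /setDP[pD pS] qV epq.
  (* A neighbour in [F] would force [p] into [F :|: S]. So [D :\: S] has no neighbour in [Q], and
     its exits in [V] already appear in [V :\: Q]. *)
  have qF : q \notin F.
    apply/negP=> qF; have pV : p \in V by case/setDP: (DVC _ pD).
    rewrite esym in epq; have := clF _ _ qF pV epq.
    by rewrite inE (negPf pS) DF.
  have qVQ : q \in V :\: Q by rewrite inE qV andbT; apply: contra qF; apply: (subsetP QF).
  have := clD _ _ pD qVQ epq; rewrite !in_setU !in_setD in_setI qF.
  by case: (q \in S); case: (q \in D) ; rewrite /= ?orbT ?orbF.
(* The degree of [x] exceeds [#|X|], so [x] has a neighbour inside [D], which supplies the edge for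
   the final count. *)
have [y yV yX] : exists2 y, y \in [set y in V :\: Q | e x y] & y \notin X.
  by apply: card_lt_ex; apply: leq_trans ltX (degk _ (DVC _ xD)).
move: yV; rewrite in_set => /andP[yV exy].
have yD : y \in D by have := clD _ _ xD yV exy; rewrite inE (negPf yX) orbF.
suff : k.*2 <= #|D| + #|X|.
  have : #|D| = #|S :&: D| by rewrite (setIidPr h4).
  by move: h3 eXF ltX; clear; lia.
apply: (triangle_free_card (degk _ (DVC _ xD)) (degk _ (DVC _ yD))).
  by move=> w /setDP[wV _]; apply: tf => //; apply: DVC.
by move=> w wV /orP[]; apply: clD.
Qed.

(** * Degree losses along an alternating path, and the induction *)

Lemma deg_le e V Q (N : {set T}) u :
  (forall w, w \in V -> w \in Q -> e u w -> w \in N) ->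
  deg e V u <= deg e (V :\: Q) u + #|N|.
Proof.
move=> QN; rewrite /deg; apply: leq_trans (leq_card_setU _ _).1.
apply/subset_leq_card/subsetP=> w; rewrite !inE => /andP[wV euw].
rewrite wV euw !andbT; case: (boolP (w \in Q)) => //= wQ; exact: QN.
Qed.

(** The colour of the first vertex takes the larger half of the sequence. Only an upper bound is
    claimed, as vertices may repeat. *)
Lemma card_alternating (c : T -> bool) x p b :
  path [rel y z | c z == ~~ c y] x p ->
  #|[set y in x :: p | c y == b]| <=
  if b == c x then uphalf (size p).+1 else (size p).+1./2.
Proof.
move=> alt.
have <- : count (fun y => c y == b) (x :: p) =
          if b == c x then uphalf (size p).+1 else (size p).+1./2.
  elim: p x alt => [|y p IH] x /=; first by case: (c x); case: b.
  case/andP=> /eqP cy /IH{IH} /= ->; rewrite cy.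
  by case: (c x); case: b => /=; lia.
rewrite -size_filter; apply: leq_trans (card_size _).
by apply/subset_leq_card/subsetP=> y; rewrite mem_filter in_set andbC.
Qed.

(** Here [m] counts edges. Relation, vertex set and clique all vary in the induction; colours,
    degrees and triangles are controlled only off [C], as none of these conditions need hold on an
    added clique. *)
Lemma alternating_path k m e V C (c : T -> bool) v0 :
  symmetric e -> kconn k.+1 e V -> C \subset V -> #|C| = k ->
  {in C &, forall x y, x != y -> e x y} ->
  (forall x y, x \in V :\: C -> y \in V :\: C -> e x y -> c y = ~~ c x) ->
  (forall u, u \in V :\: C ->
     k + (if c u == c v0 then uphalf m.+1 else m.+1./2.+1) <= deg e V u) ->
  (forall x y, x \in V :\: C -> y \in V :\: C -> e x y ->
     forall w, w \in V -> ~~ (e x w && e y w)) ->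
  v0 \in V :\: C ->
  exists p, [/\ path e v0 p, uniq (v0 :: p), size p = m,
                {subset v0 :: p <= V :\: C}
              & kconn k e (V :\: [set x in v0 :: p])].
Proof.
elim: m e V C v0 => [|m IH] e V C v0 esym kV CV cC cliq alt dg tf v0V.
  exists [::]; split=> //; first by move=> x; rewrite inE => /eqP->.
  by rewrite set_cons set_nil setU0; apply: kconnD1.
(* [add_clique] creates loops on [S], so irreflexivity is derived from the colouring, off the clique
   only. *)
have irr x : x \in V :\: C -> e x x = false.
  by move=> xV; apply/negP=> /(alt _ _ xV xV); case: (c x).
set V1 := V :\ v0.
have V1V : V1 \subset V := subD1set _ _.
have inVC x : x \in V1 :\: C -> x \in V :\: C.
  by rewrite !inE => /and3P[-> _ ->].
have kV1 : kconn k e V1 := kconnD1 v0 kV.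
have v0C : v0 \notin C by case/setDP: v0V.
have CV1 : C \subset V1.
  apply/subsetP=> x xC; rewrite !inE (subsetP CV) // andbT.
  by apply: contraNneq v0C => <-.
(* Deleting [v0] exchanges the two bounds: its own colour class loses nothing, the other class at
   most one neighbour. *)
have dg1 u : u \in V1 :\: C ->
    k + (if c u == ~~ c v0 then uphalf m.+1 else m.+1./2.+1) <= deg e V1 u.
  move=> uV; have := dg u (inVC _ uV).
  have [cu|cu] := eqVneq (c u) (c v0).
    have -> : (c u == ~~ c v0) = false by rewrite cu; case: (c v0).
    have : deg e V u <= deg e V1 u + #|@set0 T|.
      apply: deg_le => w _; rewrite inE => /eqP-> euv.
      by have := alt _ _ (inVC _ uV) v0V euv; rewrite cu; case: (c v0).
    by rewrite cards0; clear; lia.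
  have -> : c u == ~~ c v0 by move: cu; case: (c u); case: (c v0).
  have : deg e V u <= deg e V1 u + #|[set v0]| by apply: deg_le.
  by rewrite cards1; clear; lia.
suff [v1 [p [e01 v1p pV k1]]] : exists v1 p,
    [/\ e v0 v1, [&& path e v1 p, uniq (v1 :: p) & size p == m],
        {subset v1 :: p <= V1 :\: C} & kconn k e (V1 :\: [set x in v1 :: p])].
  case/and3P: v1p => path_p uniq_p /eqP size_p.
  exists (v1 :: p); split.
  - by rewrite /= e01.
  - rewrite cons_uniq uniq_p andbT; apply/negP=> /pV.
    by rewrite !inE eqxx andbF.
  - by rewrite /= size_p.
  - by move=> x; rewrite inE => /predU1P[->//|/pV]; apply: inVC.
  - by rewrite set_cons -setDDl.
have e0C w : w \in V -> w \notin C -> e v0 w ->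
    w \in V1 :\: C /\ c w = ~~ c v0.
  move=> wV wC e0w; have wVC : w \in V :\: C by rewrite inE wC.
  split; last exact: alt e0w.
  rewrite !inE wC wV andbT; apply: contraTneq e0w => ->; by rewrite irr.
have [w wN wC] : exists2 w, w \in [set y in V | e v0 y] & w \notin C.
  apply: card_lt_ex; have := dg _ v0V; rewrite eqxx cC /deg; clear; lia.
move: wN; rewrite inE => /andP[wV e0w].
have [wV1 cw] := e0C w wV wC e0w.
have [kV1'|nkV1] := boolP (kconn k.+1 e V1).
  have [] := IH e V1 C w esym kV1' CV1 cC cliq _ _ _ wV1.
  - by move=> x y /inVC xV /inVC yV; apply: alt.
  - by rewrite cw.
  - by move=> x y /inVC xV /inVC yV exy z /(subsetP V1V); apply: tf.
  move=> p [path_p uniq_p size_p pV kp].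
  by exists w, p; rewrite e0w path_p uniq_p size_p eqxx.
have deg_ge u : u \in V1 :\: C -> k < deg e V1 u.
  by move=> /dg1; case: (_ == _) => /=; clear; lia.
have bigV1 : k.+1 < #|V1|.
  have wwV1 : w \in V1 by case/setDP: wV1.
  rewrite (cardsD1 w) wwV1; apply: leq_trans (deg_ge _ wV1) _.
  apply/subset_leq_card/subsetP=> y; rewrite in_set in_setD1 => /andP[-> ewy].
  by rewrite andbT; apply: contraTneq ewy => ->; rewrite irr // inVC.
pose P F := [&& cuts e V1 F, #|nbhd e V1 F| <= k & [disjoint F & C]].
have [F0 PF0] : exists F, P F.
  have [D cD ltD] := nkconn bigV1 nkV1.
  have [F [cF leF FC]] := cuts_off_clique esym cliq cD.
  by exists F; rewrite /P cF FC (leq_trans leF).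
case: (arg_minnP (fun F => #|F|) PF0) => F /and3P[cF leF FC] minF.
have [FV1 [x0 x0F] [z0 [z0V z0F z0S]]] := cutsP _ _ _ cF.
set S := nbhd e V1 F in leF z0S.
have SF x : x \in S -> x \in F = false by case/nbhdP=> _ /negPf.
have SV1 : S \subset V1 by apply/subsetP=> x /nbhdP[].
have clF x y : x \in F -> y \in V1 -> e x y -> y \in F :|: S.
  by move=> xF yV exy; apply: nbhd_closed exy.
have cS : #|S| = k.
  apply/eqP; rewrite eqn_leq leF; case/andP: kV1 => _ /forall_inP; exact.
have FVC x : x \in F -> x \in V1 :\: C.
  by move=> xF; rewrite inE (disjointFr FC xF) (subsetP FV1).
(* Otherwise the [k] vertices of [S] would cut off [F] in [V] itself, which is [k.+1]-connected. *)
have [v1 v1F e01] : exists2 v1, v1 \in F & e v0 v1.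
  apply/exists_inP; apply: contraT; rewrite negb_exists_in => /forall_inP nF.
  suff : k.+1 <= #|S| by rewrite cS ltnn.
  apply: (kconn_cut kV _ x0F (subsetP V1V _ z0V)).
  - exact: subset_trans FV1 V1V.
  - by rewrite inE negb_or z0F.
  move=> a b aF bV eab; apply: (clF _ _ aF _ eab); rewrite !inE bV andbT.
  by apply: contraTneq eab => ->; rewrite esym nF.
have v1VC := FVC _ v1F.
have cv1 : c v1 = ~~ c v0 := alt _ _ v0V (inVC _ v1VC) e01.
have [u uN uS] : exists2 u, u \in [set y in V1 | e v1 y] & u \notin S.
  by apply: card_lt_ex; rewrite cS; apply: deg_ge.
move: uN; rewrite in_set => /andP[uV1 e1u].
have uF : u \in F by have := clF _ _ v1F uV1 e1u; rewrite inE (negPf uS) orbF.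
pose e' := add_clique e S; pose V' := F :|: S.
have e'sym : symmetric e'.
  by move=> x y; rewrite /e' /add_clique /= esym [in RHS]andbC.
have V'V1 : V' \subset V1 by rewrite subUset FV1.
have e'F x y : x \in F -> e' x y = e x y.
  move=> xF; rewrite /e' /add_clique /=.
  by case: (boolP (x \in S)) => [/SF|_]; rewrite ?xF ?orbF.
have V'F x : x \in V' :\: S -> x \in F by rewrite !inE => /andP[/negPf->]; rewrite orbF.
have dFS : [disjoint F & S].
  by apply/pred0P=> x /=; apply/negP=> /andP[xF /SF]; rewrite xF.
have bigV' : k.+1 < #|V'|.
  rewrite cardsU; have /eqP-> : F :&: S == set0 by rewrite setI_eq0.
  rewrite cards0 subn0 cS (cardsD1 u) uF (cardsD1 v1) !inE v1F andbT.
  have -> : v1 != u by apply: contraTneq e1u => ->; rewrite irr // inVC // FVC.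
  by clear; lia.
have cliqS : {in S &, forall x y, x != y -> e' x y}.
  by move=> x y xS yS _; rewrite /e' /add_clique /= xS yS orbT.
(* A cut with at most [k] neighbours gives a set [F'] inside [F] that satisfies [P]. Minimality
   forces [F' = F], but then nothing of [F :|: S] lies beyond its neighbourhood. *)
have kV' : kconn k.+1 e' V'.
  apply: contraT => /(nkconn bigV')[D cD ltD].
  have [F' [cF' leF' F'S]] := cuts_off_clique e'sym cliqS cD.
  have [F'V' [x xF'] [z [zV' zF' zN]]] := cutsP _ _ _ cF'.
  have F'F : F' \subset F.
    apply/subsetP=> y yF'; have := subsetP F'V' _ yF'.
    by rewrite inE (disjointFr F'S yF') orbF.
  have NN : nbhd e V1 F' \subset nbhd e' V' F'.
    apply/subsetP=> y /nbhdP[yV1 yF' [t tF' ety]]; apply/nbhdP; split=> //.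
      by apply: clF ety => //; apply: (subsetP F'F).
    by exists t; rewrite // e'F // (subsetP F'F).
  have PF' : P F'.
    apply/and3P; split.
    - apply/cutsP; split; first exact: subset_trans FV1.
        by exists x.
      exists z0; split=> //; first by apply: contra z0F; apply: (subsetP F'F).
      apply/negP=> /(subsetP NN)/nbhdP[].
      by rewrite inE (negPf z0F) (negPf z0S).
    - apply: leq_trans (subset_leq_card NN) _.
      by apply: leq_trans leF' _.
    - by apply: disjointWl FC.
  have eF : F' = F by apply/eqP; rewrite eqEcard F'F minF.
  move: zV' zF' zN; rewrite eF inE => /orP[->//|zS] zF; case/nbhdP.
  split=> //; first by rewrite inE zS orbT.
  by case/nbhdP: (zS) => _ _ [t tF etz]; exists t; rewrite ?e'F.
have [] := IH e' V' S v1 e'sym kV' (subsetUr _ _) cS cliqS.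
- move=> x y /V'F xF /V'F yF; rewrite e'F // => exy.
  by apply: alt exy; apply/inVC/FVC.
- move=> x /V'F xF; rewrite cv1; apply: leq_trans (dg1 _ (FVC _ xF)) _.
  apply/subset_leq_card/subsetP=> y; rewrite in_set => /andP[yV exy].
  by rewrite in_set e'F // exy andbT; apply: (clF _ _ xF yV exy).
- move=> x y /V'F xF /V'F yF; rewrite e'F // => exy t tV'; rewrite !e'F //.
  apply: tf exy _ _; try exact/inVC/FVC.
  by apply: (subsetP V1V); apply: (subsetP V'V1).
- by rewrite in_setD in_setU v1F andbT (disjointFr dFS).
move=> p [path_p uniq_p size_p pV' kp].
have pF : {subset v1 :: p <= F} by move=> x /pV' /V'F.
have path_ep : path e v1 p.
  apply: (sub_in_path (P := mem F) (e := e')) path_p; last exact/allP.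
  by move=> x y xF _; rewrite e'F.
exists v1, p; split=> //; first by rewrite path_ep uniq_p size_p eqxx.
  by move=> x /pF /FVC.
apply: (kconn_glue (C := C) (S := S) (F := F) (u := v1) (v := u)) => //.
- by apply/subsetP=> x; rewrite inE => /pF.
(* Only path vertices of the opposite colour are lost to [x], and the excess over [k] in [dg1] is at
   least their number. *)
- move=> x xV; have := dg1 x xV.
  have altp : path [rel y z | c z == ~~ c y] v1 p.
    apply: (sub_in_path (P := mem F) (e := e)) path_ep; last exact/allP.
    by move=> y z yF zF /= eyz; apply/eqP; apply: alt eyz; apply/inVC/FVC.
  have := card_alternating (~~ c x) altp.
  have : deg e V1 x <= deg e (V1 :\: [set y in v1 :: p]) x
                       + #|[set y in v1 :: p | c y == ~~ c x]|.
    apply: deg_le => y yV1; rewrite inE => yp exy; rewrite inE yp.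
    by apply/eqP; apply: alt exy; apply: inVC => //; apply/FVC/pF.
  rewrite cv1 size_p; case: (c x); case: (c v0) => /=; clear; lia.
- move=> x y /inVC xV /inVC yV exy t /(subsetP V1V); exact: tf.
Qed.

End Fragments.

(** * Agreement with vertex connectivity, and the theorem *)

Lemma leq_bigmin (I : Type) (s : seq I) (P : pred I) (f : I -> nat) k d :
  (k <= \big[minn/d]_(i <- s | P i) f i) =
  (k <= d) && all (fun i => P i ==> (k <= f i)) s.
Proof.
elim: s => [|i s IH]; first by rewrite big_nil andbT.
by rewrite big_cons /=; case: (P i) => //=; rewrite leq_min IH andbCA.
Qed.

Lemma connectivity_ge (T : finType) (G : graph T) k :
  reflect (k <= #|verts G| /\ forall S, separating G S -> k <= #|S|)
          (k <= connectivity G).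
Proof.
rewrite /connectivity leq_bigmin; apply: (iffP andP) => -[kG h]; split=> //.
  by move=> S; apply/implyP; apply: (allP h); rewrite mem_index_enum.
by apply/allP=> S _; apply/implyP/h.
Qed.

(** A disconnecting set gives a component as a cut; conversely the neighbourhood of a cut separates.
    Positivity of [k] excludes the empty graph, for which [kconn 0] fails. *)
Lemma kconnE (T : finType) (G : graph T) k :
  0 < k -> kconn k (edge G) (verts G) = (k <= connectivity G).
Proof.
move=> k_gt0; apply/idP/connectivity_ge => [kG|[kG sepG]].
  have [lt _] := andP kG; split=> [|S /andP[SG]]; first exact: ltnW.
  case/orP=> [/exists_inP[x xG /exists_inP[y yG nxy]]|/eqP c1]; last first.
    by have := cardsDS SG; rewrite /= in c1; have := subset_leq_card SG; lia.
  pose D := [set z in verts (del_verts G S) | connect (edge (del_verts G S)) x z].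
  have [yV yS] := setDP yG.
  apply: (kconn_cut (D := D) (x := x) (z := y) kG) => //.
  - by apply/subsetP=> z; rewrite !inE => /andP[/andP[_ ->]].
  - by rewrite inE xG connect0.
  - by rewrite in_setU in_set yG (negPf nxy) (negPf yS).
  move=> a b; rewrite in_set => /andP[aG xa] bV eab.
  rewrite in_setU in_set; case: (boolP (b \in S)) => bS; first by rewrite orbT.
  rewrite orbF in_setD bS bV /=; apply: connect_trans xa (connect1 _).
  by case/setDP: aG => _ aS; rewrite /= /del_edge /= eab aS.
have [v vG] : exists v, v \in verts G by apply/card_gt0P; apply: leq_trans kG.
(* Deleting all vertices but [v] is separating, which makes the order bound strict. *)
apply/andP; split.
  have : k <= #|verts G :\ v|.
    apply: sepG; rewrite /separating subD1set; apply/orP; right.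
    by rewrite /= setDDr setDv set0U (setIidPr _) ?cards1 // sub1set.
  by have := cardsD1 v (verts G); rewrite vG; lia.
apply/forall_inP=> D /cutsP[DG [x xD] [z [zG zD zN]]].
apply: sepG; apply/andP; split.
  by apply/subsetP=> y /nbhdP[].
apply/orP; left; apply/exists_inP; exists x.
  rewrite inE (subsetP DG) // andbT; apply/negP=> /nbhdP[_]; by rewrite xD.
apply/exists_inP; exists z; first by rewrite inE zN.
apply/negP=> /connectP[p path_p ez]; move: zD; rewrite ez.
elim: p x xD path_p {ez} => /= [|y p IH] x xD; first by rewrite xD.
case/andP=> /and3P[exy _ yN] /IH; apply.
have yG : y \in verts G by rewrite edge_sym in exy; apply: edge_verts exy.
by have := nbhd_closed xD yG exy; rewrite inE (negPf yN) orbF.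
Qed.

Theorem theorem3p1 (T : finType) (k m : nat) (G C : graph T) :
  0 < k -> 0 < m ->
  let t := uphalf (m + 1) in
  subgraph C G ->
  connectivity G >= k + 1 ->
  complete C -> #|verts C| = k ->
  bipartite (del_verts G (verts C)) ->
  (forall u, u \in verts G :\: verts C -> degree G u >= k + t) ->
  (forall u v, u \in verts G :\: verts C -> v \in verts G :\: verts C ->
     edge G u v -> ~ exists w, edge G u w /\ edge G v w) ->
  forall v0, v0 \in verts G :\: verts C ->
  exists2 p : seq T,
    path_of_order (del_verts G (verts C)) m v0 p &
    connectivity (del_verts G [set x in v0 :: p]) >= k.
Proof.
case: m => // m k_gt0 _ t [CG eCG] kG cliq cC [A [B [AB dAB indA indB]]] dg tf v0 v0V.
have delE x y : x \in verts G :\: verts C -> y \in verts G :\: verts C ->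
    edge (del_verts G (verts C)) x y = edge G x y.
  by move=> /setDP[_ xC] /setDP[_ yC]; rewrite /= /del_edge /= xC yC !andbT.
have degE u : degree G u = deg (edge G) (verts G) u.
  rewrite /degree /deg; apply: eq_card => y; rewrite !inE andbC.
  case: (boolP (edge G u y)) => //=.
  by rewrite edge_sym => /edge_verts ->.
(* Membership in [A] serves as the 2-colouring; the order of the path is now [m.+1]. *)
have [] := @alternating_path T k m (edge G) (verts G) (verts C) (mem A) v0
  (@edge_sym _ G) _ CG cC _ _ _ _ v0V.
- by rewrite kconnE // -addn1.
- by move=> x y xC yC /(cliq _ _ xC yC); apply: eCG.
- move=> x y xV yV exy; rewrite -delE // in exy.
  have inAB z : z \in verts G :\: verts C -> z \notin A -> z \in B.
    by move=> zV zA; move: zV; rewrite -[_ :\: _]AB inE (negPf zA).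
  rewrite /=; case: (boolP (x \in A)) => xA; case: (boolP (y \in A)) => yA //.
    by have := indA x y xA yA; rewrite exy.
  by have := indB x y (inAB _ xV xA) (inAB _ yV yA); rewrite exy.
(* Here [t] equals [m.+1./2.+1], the larger of the two asymmetric bounds. *)
- move=> u uV; rewrite -degE; apply: leq_trans (dg u uV).
  by rewrite /t; case: (_ == _); clear; lia.
- move=> x y xV yV exy w _; apply/negP=> /andP[exw eyw].
  by case: (tf x y xV yV exy); exists w.
move=> p [path_p uniq_p size_p pV kp]; exists p.
  apply/and4P; split=> //; last by rewrite /= size_p.
  apply: (sub_in_path (P := mem (verts G :\: verts C)) (e := edge G)) path_p; last exact/allP.
  by move=> x y xV yV; rewrite delE.
rewrite -kconnE // -(eq_kconn _ (e := edge G)) //.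
by move=> x y /setDP[_ xp] /setDP[_ yp]; rewrite /= /del_edge /= xp yp !andbT.
Qed.
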